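(* Assume the following conditions. (i) There exist positive absolute constants $\xi_1,\xi_2,\xi_3$ such that, for every sufficiently large $n$ and every $\theta\in\Theta_n$, $$P_\star^{(n)}\left[\exp(-\lambda\{\ell_n(\theta)-\ell_n^\star\})\right]\le \exp(-\xi_1\mathcal L_n(\theta)),\qquad P_\star^{(n)}\left[\exp(\lambda\xi_2\{\ell_n(\theta)-\ell_n^\star\})\right]\le \exp(\xi_3\mathcal L_n(\theta)).$$ (ii) There exists an absolute constant $\xi_4>0$ such that, for every sufficiently large $n$ and every $k\in[M_n]$, there is a distribution $Q^*_{n,k}\in\mathcal Q_{n,k}$ with $$\log\left(\int\exp(\xi_3\mathcal L_n(\theta))\,dQ^*_{n,k}(\theta)\right)\le \xi_4\mathcal E_n(k),\qquad \mathrm{KL}(Q^*_{n,k},\Pi_{n,k})\le\xi_4\mathcal E_n(k).$$ Let $\tau_*>0$ and $C_2>0$ be absolute constants such that, for every sufficiently large $n$, $$P_\star^{(n)}\left(\widehat m_n\ge \min\{k_n^\dagger(\tau_* )+1,M_n\}\right)\ge 1-\eta_n,\qquad \eta_n:=k_n^\dagger(\tau_* )\exp\left(-C_2\,\mathcal E_n(k_n^\dagger(\tau_* ))\right)$$ (under (i) and (ii) such constants exist), and let $\mathcal E_n^*:=\min\{\mathcal E_n(k):k\in[M_n],\ k\le k_n^\dagger(\tau_* )+1\}$. Assume that $\eta_n\to0$ as $n\to\infty$. Then for any sequence $(A_n)_{n\in\mathbb N}$ with $A_n\to\infty$, $$P_\star^{(n)}\left[\widehat Q_n^{\mathrm{ESA}}\left(\mathcal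 L_n(\theta)\ge A_n(\mathcal E_n^*+\log M_n)\right)\right]\to0\quad\text{as }n\to\infty.$$
   Context: Setup. For each $n$, a sample $X^{(n)}$ with values in a measurable space $\mathcal X_n$ is drawn from the true distribution $P_\star^{(n)}$; $P_\star^{(n)}[\cdot]$ denotes expectation and $P_\star^{(n)}(\cdot)$ probability under it. $\mathcal P(\cdot)$ is the set of probability measures on a space; $[m]=\{1,\dots,m\}$. The models are parameter spaces $\Theta_{n,1},\dots,\Theta_{n,M_n}$, each $\theta$ indexing a distribution $P_\theta^{(n)}\in\mathcal P(\mathcal X_n)$, and they are nested: for each $k<M_n$ there is an embedding $T:\Theta_{n,k}\to\Theta_{n,k+1}$ with $P^{(n)}_\theta=P^{(n)}_{T(\theta)}$ for all $\theta\in\Theta_{n,k}$. Put $\Theta_n=\bigcup_{k=1}^{M_n}\Theta_{n,k}$; distributions on $\Theta_{n,k}$ are regarded as distributions on $\Theta_n$. A loss $\ell_n:\mathcal P(\mathcal X_n)\times\mathcal X_n\to[0,\infty)$ is given; write $\ell_n(\theta)=\ell_n(P_\theta^{(n)},X^{(n)})$ and $\ell_n^\star=\ell_n(P_\star^{(n)},X^{(n)})$. The excess risk is $\mathcal L_n(\theta)=P_\star^{(n)}[\ell_n(\theta)-\ell_n^\star]$. $\mathrm{KL}(P_1,P_2)=\int\log(dP_1/dP_2)\,dP_1$ if $P_1\ll P_2$, and $\infty$ otherwise. ''Absolute constant'' means a constant not depending on $n$ or $k$. Variational Bayes. $\lambda>0$ is a fixed constant (learning rate). For each $k\in[M_n]$,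 $\Pi_{n,k}$ is a prior distribution on $\Theta_{n,k}$ and $\mathcal Q_{n,k}\subset\mathcal P(\Theta_{n,k})$ is a variational family. The variational posterior $\widehat Q_{n,k}$ is a minimizer over $Q\in\mathcal Q_{n,k}$ of $\lambda\int\ell_n(\theta)\,dQ(\theta)+\mathrm{KL}(Q,\Pi_{n,k})$, and $\mathrm{mVFE}_n(k)$ is the minimum value. Stopping index: $\widehat m_n=\inf\{k\in[M_n]\setminus\{1\}:\mathrm{mVFE}_n(k-1)<\mathrm{mVFE}_n(k)\}\wedge M_n$ (with $\inf\emptyset=\infty$). ESA variational posterior: $\widehat Q_n^{\mathrm{ESA}}=\sum_{k=1}^{\widehat m_n}\widehat\omega_{n,k}\widehat Q_{n,k}$ with $\widehat\omega_{n,k}=\exp(-\mathrm{mVFE}_n(k))/\sum_{k'=1}^{\widehat m_n}\exp(-\mathrm{mVFE}_n(k'))$. Excess risk of model $k$: $\mathcal E_n(k)=-\log\left(\int\exp(-\xi_1\mathcal L_n(\theta))\,d\Pi_{n,k}(\theta)\right)$, with the same constant $\xi_1$ as in condition (i). Near-optimal index: for $\tau>0$, $k_n^\dagger(\tau)$ is the smallest $k\in[M_n-1]$ with $\mathcal E_n(k)\le(1+\tau)\mathcal E_n(k+1)$, and $k_n^\dagger(\tau)=M_n$ if there is no such $k$. *)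

(* Defs.v *)
From HB Require Import structures.
From mathcomp Require Import all_boot all_order all_algebra.
From mathcomp Require Import all_classical all_reals all_analysis.

Set Implicit Arguments.
Unset Strict Implicit.
Unset Printing Implicit Defensive.

Import Order.TTheory GRing.Theory Num.Theory.
Import numFieldNormedType.Exports.

Local Open Scope classical_set_scope.
Local Open Scope ring_scope.
Local Open Scope charge_scope.
Local Open Scope ereal_scope.

Definition KL d (T : measurableType d) (R : realType)
    (P1 P2 : probability T R) : \bar R :=
  if `[< P1 `<< P2 >]
  then \int[P1]_x lne (('d (charge_of_finite_measure P1) '/d P2) x)
  else +oo.

(* The expectation is taken in \bar R: a non-integrable difference of losses
   gives the excess risk an infinite value. *)
Definition excess_risk d (X : measurableType d) (R : realType)
    (Pstar : probability X R) (ell : probability X R -> X -> R)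
    (P : probability X R) : \bar R :=
  'E_Pstar[(fun x => ell P x - ell Pstar x)%R].

Definition vb_objective d (T : measurableType d) (R : realType) (lambda : R)
    (loss : T -> R) (Pi Q : probability T R) : \bar R :=
  lambda%:E * (\int[Q]_theta (loss theta)%:E) + KL Q Pi.

Definition is_minimizer (T : Type) (R : realType) (f : T -> \bar R)
    (S : set T) (x : T) : Prop :=
  S x /\ forall y, S y -> f x <= f y.

Definition mVFE d (T : measurableType d) (R : realType) (lambda : R)
    (loss : T -> R) (Pi : probability T R) (F : set (probability T R)) :
    \bar R :=
  ereal_inf [set vb_objective lambda loss Pi Q | Q in F].

(* Seeding the minimum with M encodes inf {...} \wedge M, with inf of the empty
   set equal to +oo. *)
Definition stopping_index (R : realType) (M : nat) (v : nat -> \bar R) : nat :=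
  \big[minn/M]_(2 <= k < M.+1 | v k.-1 < v k) k.

Definition esa_weight (R : realType) (m : nat) (v : nat -> \bar R) (k : nat) :
    \bar R :=
  expeR (- v k) / \sum_(1 <= j < m.+1) expeR (- v j).

(* The union of the parameter spaces is represented by the disjoint union
   {k & Theta k}; Q k is regarded as a distribution on it by pushing it forward
   along the k-th injection. *)
Definition esa_mixture (R : realType) (dT : nat -> measure_display)
    (Theta : forall k, measurableType (dT k)) (m : nat) (v : nat -> \bar R)
    (Q : forall k, probability (Theta k) R) (A : set {k : nat & Theta k}) :
    \bar R :=
  \sum_(1 <= k < m.+1)
    esa_weight m v k * Q k (existT (fun j => Theta j : Type) k @^-1` A).

Definition model_excess_risk d (T : measurableType d) (R : realType) (xi1 : R)
    (L : T -> \bar R) (Pi : probability T R) : \bar R :=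
  - lne (\int[Pi]_theta expeR (- (xi1%:E * L theta))).

(* The seed M is the value when no k in [M - 1] qualifies. *)
Definition near_optimal_index (R : realType) (M : nat) (E : nat -> \bar R)
    (tau : R) : nat :=
  \big[minn/M]_(1 <= k < M | E k <= (1 + tau)%:E * E k.+1) k.

(* min {E k : k in [M], k <= b} *)
Definition min_upto (R : realType) (M b : nat) (E : nat -> \bar R) : \bar R :=
  \big[Order.min/+oo]_(1 <= k < M.+1 | (k <= b)%N) E k.

(* Main.v *)
(** The theorem follows from a bound in expectation. Put [r = A (E^* + log M)]
    and let [k*] attain [E^*]. The Donsker-Varadhan inequality, applied to the
    variational posterior of model [k] and the test function
    [xi1 r 1{L >= r} - lambda (l - l^* )], gives
    [xi1 r Q_k(L >= r) <= mVFE(k) - lambda l^* + log M + Y_k] with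
    [P^* Y_k <= 2 / M] by condition (i). As soon as [k*] is at most the stopping
    index, the weights satisfy [w_k <= exp(mVFE(k* ) - mVFE(k))], so
    [sum_k w_k mVFE(k) <= mVFE(k* ) + log M + 1], and condition (ii) bounds
    [mVFE(k* ) - lambda l^*] in expectation by a multiple of [E^* + 1]. Hence
    the posterior mass of [{L >= r}] has expectation at most
    [eta_n + C (E^* + log M + 1) / r]. Finally [eta_n -> 0] forces [E(kd)] to
    infinity, hence also [E^* >= E(kd) / (1 + tau)], which absorbs the [1].

    The excess risk may be negative; [E(k) >= 0] comes from condition (ii), as
    the KL divergence is nonnegative. *)
Require Import Defs.
From HB Require Import structures.
From mathcomp Require Import all_boot all_order all_algebra.
From mathcomp Require Import all_classical all_reals all_analysis.
From mathcomp Require Import measurable_realfun.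
From mathcomp Require Import ring lra.

Set Implicit Arguments.
Unset Strict Implicit.
Unset Printing Implicit Defensive.

Import Order.TTheory GRing.Theory Num.Theory.
Import numFieldNormedType.Exports.

Local Open Scope classical_set_scope.
Local Open Scope ring_scope.

(** * Monotonicity of integrals and real-valued Radon-Nikodym densities *)

(** The integral of a nonnegative function is a supremum over the simple functions below it, and a
    larger function has more of them. Used on the posterior mass as a function of the sample. *)
Lemma ge0_le_integral_any d (T : measurableType d) (R : realType)
    (mu : {measure set T -> \bar R}) (f g : T -> \bar R) :
  (forall x, 0 <= f x)%E -> (forall x, f x <= g x)%E ->
  (\int[mu]_x f x <= \int[mu]_x g x)%E.
Proof.
move=> f0 fg; have g0 x : (0 <= g x)%E := le_trans (f0 x) (fg x).
rewrite !ge0_integralTE//; apply: le_ereal_sup => _ [h /= hf <-].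
by exists h => // x; exact: le_trans (hf x) (fg x).
Qed.

Lemma integral_cst_probability d (T : measurableType d) (R : realType)
    (P : probability T R) (c : \bar R) : (\int[P]_x c = c)%E.
Proof.
have := integral_cst P measurableT c => /= ->.
by rewrite probability_setT mule1.
Qed.

(** A version of dQ/dP that is finite and nonnegative at every point once [Q] is dominated by [P];
    it agrees almost everywhere with the derivative in [KL]. *)
Definition density d (T : measurableType d) (R : realType)
    (P Q : probability T R) (x : T) : R :=
  fine (Radon_Nikodym_SigmaFinite.f Q P x).

Lemma measurable_density d (T : measurableType d) (R : realType)
    (P Q : probability T R) : Q `<< P -> measurable_fun setT (density P Q).
Proof.
move=> QP; apply: measurableT_comp => //.
exact: measurable_int (Radon_Nikodym_SigmaFinite.f_integrable QP).
Qed.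

Lemma EFin_density d (T : measurableType d) (R : realType)
    (P Q : probability T R) (x : T) : Q `<< P ->
  Radon_Nikodym_SigmaFinite.f Q P x = (density P Q x)%:E.
Proof.
by move=> QP; rewrite fineK//; exact: Radon_Nikodym_SigmaFinite.f_fin_num.
Qed.

Lemma density_ge0 d (T : measurableType d) (R : realType)
    (P Q : probability T R) (x : T) : Q `<< P -> 0 <= density P Q x.
Proof. by move=> QP; rewrite fine_ge0// Radon_Nikodym_SigmaFinite.f_ge0. Qed.

(** The [Q]-mass of the zero set of the density is the [P]-integral of the density over that set. *)
Lemma density_gt0_ae d (T : measurableType d) (R : realType)
    (P Q : probability T R) : Q `<< P ->
  \forall x \ae Q, 0 < density P Q x.
Proof.
move=> QP; have mp0 : measurable [set x | density P Q x = 0].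
  have := measurable_density QP measurableT (measurable_set1 0).
  by rewrite setTI.
exists [set x | density P Q x = 0]; split => //.
  rewrite (Radon_Nikodym_SigmaFinite.f_integral QP)//.
  rewrite (eq_integral (cst 0%E)) ?integral0// => x /[!inE] /= px0.
  by rewrite EFin_density// px0.
move=> x /=; apply: contra_notP => px0.
by rewrite lt_neqAle eq_sym density_ge0// andbT; apply/eqP.
Qed.

(** The two derivatives agree [P]-almost everywhere, hence [Q]-almost everywhere by domination.
    There the density is also positive, so [lne] and [ln] coincide. *)
Lemma KL_density d (T : measurableType d) (R : realType)
    (P Q : probability T R) : Q `<< P ->
  KL Q P = (\int[Q]_x (ln (density P Q x))%:E)%E.
Proof.
move=> QP; rewrite /KL asboolT//; have mp := measurable_density QP.
set g := Radon_Nikodym _ _.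
have gfin x : g x = (fine (g x))%:E by rewrite fineK ?Radon_Nikodym_fin_num.
have mg : measurable_fun setT g.
  have H := @Radon_Nikodym_integrable _ _ _ (charge_of_finite_measure Q) P QP.
  exact: measurable_int H.
apply: ae_eq_integral => //.
- have -> : (fun x => lne (g x)) =
      (fun x => if fine (g x) <= 0 then -oo%E else (ln (fine (g x)))%:E).
    by apply/funext => x; rewrite {1}gfin.
  apply: measurable_fun_ifT => //.
    by apply: measurable_fun_ler => //; exact: measurableT_comp.
  by apply/measurable_EFinP; do 2 apply: measurableT_comp => //.
- by apply/measurable_EFinP; exact: measurableT_comp.
- have := density_gt0_ae QP.
  have := null_dominates_ae_eq measurableT QP
    (ae_eq_Radon_Nikodym_SigmaFinite QP measurableT).
  apply: filterS2 => x /(_ I) pg p0 _.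
  rewrite (_ : g x = (density P Q x)%:E); first by rewrite lne_EFin.
  by rewrite -EFin_density//; exact: esym pg.
Qed.

(** * The Donsker-Varadhan inequality *)

(** Changing variables multiplies the integrand by the density: this gives [expR u] where the
    density is positive and [0 * +oo = 0] elsewhere. The value [+oo] on the zero set lets later
    pointwise bounds hold everywhere. *)
Lemma integral_div_density_le d (T : measurableType d) (R : realType)
    (P Q : probability T R) (u : T -> R) : Q `<< P ->
  measurable_fun setT u ->
  (\int[Q]_x (if (density P Q x <= 0)%R then +oo
               else (expR (u x - ln (density P Q x)))%:E)
     <= \int[P]_x (expR (u x))%:E)%E.
Proof.
move=> QP mu; set q := density P Q.
have mq : measurable_fun setT q by exact: measurable_density.
have mh : measurable_fun setT
    (fun x => if q x <= 0 then +oo%E else (expR (u x - ln (q x)))%:E).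
  apply: measurable_fun_ifT => //; first exact: measurable_fun_ler.
  apply/measurable_EFinP; apply: measurableT_comp => //.
  by apply: measurable_funB => //; exact: measurableT_comp.
have h0 x : (0 <= if (q x <= 0)%R then +oo else (expR (u x - ln (q x))%R)%:E)%E.
  by case: ifPn => // _; rewrite lee_fin expR_ge0.
rewrite -(Radon_Nikodym_SigmaFinite.change_of_variables QP)//.
apply: ge0_le_integral => //.
- by move=> x _; rewrite mule_ge0// Radon_Nikodym_SigmaFinite.f_ge0.
- apply: emeasurable_funM => //.
  exact: measurable_int (Radon_Nikodym_SigmaFinite.f_integrable QP).
- by apply/measurable_EFinP; exact: measurableT_comp.
move=> x _; have q0 : 0 <= q x.
  exact: density_ge0.
rewrite EFin_density// -/(q x); case: ifPn => [qx0|]; last first.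
  rewrite -ltNge => qx0; rewrite -EFinM lee_fin expRB lnK ?posrE//.
  by rewrite divfK// gt_eqF.
have -> : q x = 0 by apply/eqP; rewrite eq_le qx0.
by rewrite mule0 lee_fin expR_ge0.
Qed.

(* Integrate [1 + y <= expR y] at [y = phi - psi - ln p], with [p] the density
   of [Q] with respect to [P]. *)
Lemma KL_variational_ge d (T : measurableType d) (R : realType)
    (P Q : probability T R) (phi psi : T -> R) :
  measurable_fun setT phi -> measurable_fun setT psi ->
  (forall x, 0 <= phi x) -> (forall x, 0 <= psi x) ->
  (\int[Q]_x (phi x)%:E + 1 <=
   \int[Q]_x (psi x)%:E + KL Q P + \int[P]_x (expR (phi x - psi x))%:E)%E.
Proof.
move=> mphi mpsi phi0 psi0.
have J0 : (0 <= \int[Q]_x (psi x)%:E)%E.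
  by apply: integral_ge0 => x _; rewrite lee_fin.
have H0 (u : T -> R) : (0 <= \int[P]_x (expR (u x))%:E)%E.
  by apply: integral_ge0 => x _; rewrite lee_fin expR_ge0.
have [QP|nQP] := pselect (Q `<< P); last first.
  rewrite /KL asboolF// addey ?addye ?leey//.
    by rewrite -ltNye (lt_le_trans _ (H0 _))// ltNyr.
  by rewrite -ltNye (lt_le_trans _ J0)// ltNyr.
rewrite KL_density//; set q := density P Q.
have mq : measurable_fun setT q by exact: measurable_density.
pose h u x := (if (q x <= 0)%R then +oo else (expR (u x - ln (q x))%R)%:E)%E.
have mh u : measurable_fun setT u -> measurable_fun setT (h u).
  move=> mu; apply: measurable_fun_ifT => //; first exact: measurable_fun_ler.
  apply/measurable_EFinP; apply: measurableT_comp => //.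
  by apply: measurable_funB => //; exact: measurableT_comp.
have h0 u x : (0 <= h u x)%E.
  by rewrite /h; case: ifPn => // _; rewrite lee_fin expR_ge0.
have hle u : measurable_fun setT u ->
    (\int[Q]_x h u x <= \int[P]_x (expR (u x))%:E)%E.
  by move=> mu; exact: integral_div_density_le.
pose u x := phi x - psi x.
pose lq x := (ln (q x))%:E.
have mlq : measurable_fun setT lq.
  by apply/measurable_EFinP; exact: measurableT_comp.
(* The negative part of [ln q] is at most [1 / q], whose [Q]-integral is at most 1 (the case
   [u = 0]). So the integral defining [KL] is never of the form [oo - oo]. *)
have Lm1 : (\int[Q]_x lq^\- x <= 1)%E.
  have <- : (\int[P]_x (expR ((cst 0 : T -> R) x))%:E = 1)%E.
    under eq_integral do rewrite /= expR0.
    exact: integral_cst_probability.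
  apply: le_trans (hle (cst 0) _); last exact: measurable_cst.
  apply: ge0_le_integral => //.
  - exact: measurable_funeneg.
  - exact/mh/measurable_cst.
  move=> x _; rewrite /h; case: ifPn => [_|_]; first exact: leey.
  rewrite funenegE /lq /= -?EFinN -EFin_max lee_fin ge_max expR_ge0 andbT sub0r.
  by rewrite (le_trans _ (expR_ge1Dx _))// lerDr.
have Lm0 : (0 <= \int[Q]_x lq^\- x)%E by exact: integral_ge0.
(* The negative part stands on the left so that every integrand is nonnegative and integrals add;
   being finite, it is moved back afterwards. *)
have mainle : (\int[Q]_x (phi x)%:E + 1 + \int[Q]_x lq^\- x <=
    \int[Q]_x (psi x)%:E + \int[Q]_x lq^\+ x +
      \int[Q]_x h u x)%E.
  have <- : (\int[Q]_x (cst 1%:E x) = 1)%E.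
    exact: integral_cst_probability.
  have mphi' : measurable_fun setT (EFin \o phi) by exact/measurable_EFinP.
  have mpsi' : measurable_fun setT (EFin \o psi) by exact/measurable_EFinP.
  have mlp := measurable_funepos mlq.
  have mln := measurable_funeneg mlq.
  have mhd : measurable_fun setT (h u).
    by apply: mh; exact: measurable_funB.
  rewrite -!ge0_integralD//; try by [move=> x _; rewrite lee_fin|
    move=> x _; rewrite adde_ge0// lee_fin|exact: emeasurable_funD].
  apply: ge0_le_integral => //.
  - by move=> x _; rewrite !adde_ge0// lee_fin.
  - by apply: emeasurable_funD => //; exact: emeasurable_funD.
  - by apply: emeasurable_funD => //; exact: emeasurable_funD.
  move=> x _; rewrite /h; case: ifPn => [_|_].
    rewrite addey ?leey// -ltNye (@lt_le_trans _ _ 0%E)// ?ltNyr//.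
    by rewrite adde_ge0// lee_fin.
  rewrite funenegE funeposE /lq /= -?EFinN -!EFin_max -!EFinD lee_fin.
  have := expR_ge1Dx (phi x - psi x - ln (q x)).
  rewrite /Num.max; do 2 case: ifPn; rewrite ?oppr_lt0 -?leNgt; lra.
rewrite [X in (_ + X + _)%E]integralE -/lq.
have mfin : (\int[Q]_x lq^\- x)%E \is a fin_num.
  by rewrite ge0_fin_numE// (le_lt_trans Lm1)// ltry.
rewrite addeA addeAC leeBrDr//.
apply: (le_trans mainle); rewrite leeD2l//.
by apply: (hle u); exact: measurable_funB.
Qed.

Lemma KL_ge0 d (T : measurableType d) (R : realType) (P Q : probability T R) :
  (0 <= KL Q P)%E.
Proof.
have c0 : measurable_fun setT (cst 0 : T -> R) by exact: measurable_cst.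
have := @KL_variational_ge _ _ _ P Q (cst 0) (cst 0) c0 c0
  (fun=> lexx 0) (fun=> lexx 0).
rewrite !integral0 !add0e.
under eq_integral do rewrite /= subr0 expR0.
rewrite integral_cst_probability.
by rewrite -[X in (X <= _)%E]add0e leeD2rE.
Qed.

(** * An entropy estimate; the near-optimal and stopping indices *)

(** With [y = u - ln M > 0], the product is at most [expR (- ln M) * (y * expR (- y))], and
    [y <= expR y]. Here [u] is the gap between two objectives, and at most [M] such errors add up to
    at most 1. *)
Lemma mulr_expN_le (R : realType) (w u : R) (M : nat) :
  (0 < M)%N -> 0 <= w -> w <= expR (- u) -> w * (u - ln M%:R) <= M%:R^-1.
Proof.
move=> M0 w0 wu; set b := ln M%:R.
have MP : M%:R \is @Num.pos R by rewrite posrE ltr0n.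
have -> : M%:R^-1 = expR (- b) by rewrite expRN lnK.
have [ub|bu] := leP (u - b) 0.
  by rewrite (le_trans _ (expR_ge0 _))// mulr_ge0_le0.
rewrite (le_trans (ler_wpM2r (ltW bu) wu))//.
have -> : - u = - b - (u - b) by lra.
rewrite expRD -mulrA ler_piMr ?expR_ge0// expRN mulrC ler_pdivrMr ?expR_gt0//.
by rewrite mul1r (le_trans _ (expR_ge1Dx _))// lerDr.
Qed.

Lemma leq_bigminn (r : seq nat) (P : pred nat) (m M : nat) :
  (m <= \big[minn/M]_(k <- r | P k) k)%N =
  (m <= M)%N && all (fun k => P k ==> (m <= k)%N) r.
Proof.
elim: r => [|k r IHr]; first by rewrite big_nil andbT.
rewrite big_cons /=; case: ifP => Pk /=; last exact: IHr.
by rewrite leq_min IHr andbCA.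
Qed.

Lemma bigminn_eq (r : seq nat) (P : pred nat) (M : nat) :
  \big[minn/M]_(k <- r | P k) k = M \/
  exists2 k, k \in r & P k /\ \big[minn/M]_(k <- r | P k) k = k.
Proof.
elim: r => [|k r IHr]; first by left; rewrite big_nil.
rewrite big_cons; case: ifP => Pk; last first.
  case: IHr => [->|[j jr Pj]]; first by left.
  by right; exists j; rewrite ?inE ?jr ?orbT.
set m := \big[_/_]_(_ <- _ | _) _; rewrite -/m in IHr.
have [km|mk] := leqP k m.
  by right; exists k; rewrite ?mem_head.
case: IHr => [->|[j jr Pj]]; first by left.
by right; exists j; rewrite ?inE ?jr ?orbT.
Qed.

Lemma near_optimal_index_bounds (R : realType) (M : nat) (E : nat -> \bar R)
    (tau : R) : (0 < M)%N -> (1 <= near_optimal_index M E tau <= M)%N.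
Proof.
move=> M0; rewrite leq_bigminn M0 /=; apply/andP; split.
  by apply/allP => k; rewrite mem_index_iota => /andP[k1 _]; rewrite k1 implybT.
rewrite /near_optimal_index.
have [->//|[k + [_ ->]]] := bigminn_eq (index_iota 1 M)
  (fun k => E k <= (1 + tau)%:E * E k.+1)%E M.
by rewrite mem_index_iota => /andP[_ /ltnW].
Qed.

Lemma near_optimal_index_min (R : realType) (M : nat) (E : nat -> \bar R)
    (tau : R) (k : nat) :
  (1 <= k < M)%N -> (k < near_optimal_index M E tau)%N ->
  ((1 + tau)%:E * E k.+1 < E k)%E.
Proof.
move=> kM kk; rewrite ltNge; apply/negP => Ek.
move: kk; rewrite leq_bigminn => /andP[_ /allP/(_ k)].
by rewrite mem_index_iota kM Ek ltnn => /(_ isT).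
Qed.

Lemma near_optimal_indexP (R : realType) (M : nat) (E : nat -> \bar R)
    (tau : R) (k := near_optimal_index M E tau) : (k < M)%N ->
  (E k <= (1 + tau)%:E * E k.+1)%E.
Proof.
rewrite /k /near_optimal_index.
have [->|[j _ [Ej ->]]//] := bigminn_eq (index_iota 1 M)
  (fun k => E k <= (1 + tau)%:E * E k.+1)%E M.
by rewrite ltnn.
Qed.

Lemma stopping_index_bounds (R : realType) (M : nat) (v : nat -> \bar R) :
  (0 < M)%N -> (1 <= stopping_index M v <= M)%N.
Proof.
move=> M0; rewrite leq_bigminn M0 /=; apply/andP; split.
  apply/allP => k; rewrite mem_index_iota => /andP[k1 _].
  by apply/implyP => _; exact: ltnW.
rewrite /stopping_index.
have [->//|[k + [_ ->]]] := bigminn_eq (index_iota 2 M.+1)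
  (fun k => v k.-1 < v k)%E M.
by rewrite mem_index_iota ltnS => /andP[].
Qed.

Lemma le_min_upto (R : realType) (M b : nat) (E : nat -> \bar R) (c : \bar R) :
  (forall k, (1 <= k <= M)%N -> (k <= b)%N -> (c <= E k)%E) ->
  (c <= min_upto M b E)%E.
Proof.
move=> cE; rewrite /min_upto big_seq_cond; elim/big_rec : _ => [|k x].
  exact: leey.
rewrite mem_index_iota ltnS => /andP[kM kb] cx.
by rewrite le_min cE.
Qed.

Lemma min_upto_eq (R : realType) (M b : nat) (E : nat -> \bar R) :
  min_upto M b E = +oo%E \/
  exists k, [/\ (1 <= k <= M)%N, (k <= b)%N & min_upto M b E = E k].
Proof.
rewrite /min_upto big_seq_cond; elim/big_rec : _ => [|k x]; first by left.
rewrite mem_index_iota ltnS => /andP[kM kb] IHx.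
have [_|_] := leP (E k) x; first by right; exists k.
exact: IHx.
Qed.

(* Below the near-optimal index, [E] decreases by a factor [1 + tau] at each
   step, and it loses at most this factor at the next step. *)
Lemma min_upto_near_optimal_ge (R : realType) (M : nat) (E : nat -> \bar R)
    (tau c : R) (kd := near_optimal_index M E tau) : (0 < M)%N -> 0 < tau ->
  (forall k, (1 <= k <= M)%N -> (0 <= E k)%E) ->
  (((1 + tau) * c)%:E <= E kd)%E -> (c%:E <= min_upto M kd.+1 E)%E.
Proof.
move=> M0 tau0 E0 ckd; apply: le_min_upto => k /andP[k1 kM] kkd.
have tau1 : 0 < 1 + tau by rewrite addr_gt0.
have /andP[kd1 kdM] : (1 <= kd <= M)%N by exact: near_optimal_index_bounds.
have [c0|c0] := leP c 0.
  by rewrite (@le_trans _ _ 0%E)// ?lee_fin// E0// k1.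
have cc : c <= (1 + tau) * c by rewrite ler_peMl ?(ltW c0)// lerDl ltW.
(* Only the index [kd.+1] costs the factor [1 + tau], which the hypothesis on [E kd] holds in
   reserve. *)
have [kE|kNkd] := eqVneq k kd.+1.
  rewrite kE in kM *.
  rewrite -(@lee_pmul2l _ (1 + tau)%:E) ?lte_fin// -EFinM (le_trans ckd)//.
  exact: near_optimal_indexP.
have {kkd kNkd} kkd : (k <= kd)%N by rewrite -ltnS ltn_neqAle kNkd.
(* Downward induction from [kd]: an index below [kd] fails the defining inequality, so its value
   exceeds the next one. *)
suff H j : (j < kd)%N -> (((1 + tau) * c)%:E <= E (kd - j)%N)%E.
  rewrite (@le_trans _ _ ((1 + tau) * c)%:E) ?lee_fin//.
  by rewrite -(subKn kkd); apply: H; rewrite ltn_subrL k1.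
elim: j => [|j IHj] jkd; first by rewrite subn0.
have {}IHj := IHj (ltnW jkd).
have jS : (kd - j)%N = (kd - j.+1).+1 by rewrite subnSK// ltnW.
have j0 : (1 <= kd - j.+1)%N by rewrite subn_gt0.
have jM : (kd - j.+1 < M)%N by rewrite (leq_trans _ kdM)// ltn_subrL.
have := @near_optimal_index_min R M E tau (kd - j.+1); rewrite j0 jM.
rewrite ltn_subrL kd1 => /(_ isT isT)/ltW; apply: le_trans.
rewrite -jS (le_trans IHj)// lee_pemull//; last by rewrite lee_fin lerDl ltW.
by rewrite E0// subn_gt0 (ltnW jkd)/= (leq_trans (leq_subr _ _)).
Qed.

(** * Exponential weights and the aggregated mass *)

(** At nonnegative [v j] the exponentials are finite, so [fine] loses nothing and the weights can be
    handled by real arithmetic. *)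
Definition esa_real_weight (R : realType) (m : nat) (v : nat -> \bar R)
    (k : nat) : R :=
  fine (expeR (- v k)) / \sum_(1 <= j < m.+1) fine (expeR (- v j)).

Lemma expeRN_fin (R : realType) (x : \bar R) : (0 <= x)%E ->
  expeR (- x) \is a fin_num.
Proof. by case: x => [r| |]. Qed.

Lemma fine_expeR_ge0 (R : realType) (x : \bar R) : 0 <= fine (expeR x).
Proof. by rewrite fine_ge0// expeR_ge0. Qed.

(* If all weights vanish, the junk quotients [0 / 0] are [0] in [\bar R] as well
   as in [R]. *)
Lemma esa_weightE (R : realType) (m : nat) (v : nat -> \bar R) (k : nat) :
  (forall j, (1 <= j <= m)%N -> (0 <= v j)%E) -> (1 <= k <= m)%N ->
  esa_weight m v k = (esa_real_weight m v k)%:E.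
Proof.
move=> v0 km; rewrite /esa_weight /esa_real_weight.
have -> : (\sum_(1 <= j < m.+1) expeR (- v j) =
    (\sum_(1 <= j < m.+1) fine (expeR (- v j)))%:E)%E.
  rewrite -sumEFin; apply: eq_big_nat => j jm.
  by rewrite fineK// expeRN_fin// v0.
rewrite -[X in (X / _)%E]fineK ?expeRN_fin ?v0//.
set s := \sum_(_ <= _ < _) _; have [s0|sN0] := eqVneq s 0; last first.
  by rewrite inver (negPf sN0).
suff -> : fine (expeR (- v k)) = 0 by rewrite s0 !mul0e mul0r.
apply/eqP; rewrite eq_le fine_expeR_ge0 andbT -s0 /s.
rewrite (bigD1_seq k) ?iota_uniq//=.
  by rewrite lerDl sumr_ge0// => j _; exact: fine_expeR_ge0.
by rewrite mem_index_iota ltnS.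
Qed.

Lemma esa_real_weight_ge0 (R : realType) (m : nat) (v : nat -> \bar R)
    (k : nat) : 0 <= esa_real_weight m v k.
Proof.
by rewrite divr_ge0 ?sumr_ge0 ?fine_expeR_ge0// => j _; exact: fine_expeR_ge0.
Qed.

(** If the normaliser vanishes, all quotients are 0; otherwise the sum is exactly 1. *)
Lemma sum_esa_real_weight_le1 (R : realType) (m : nat) (v : nat -> \bar R) :
  \sum_(1 <= k < m.+1) esa_real_weight m v k <= 1.
Proof.
rewrite -mulr_suml; set s := \sum_(_ <= _ < _) _.
by have [->|s0] := eqVneq s 0; rewrite ?mul0r// divff.
Qed.

(** The normaliser is at least its [j]-th term [expR (- x)]. *)
Lemma esa_real_weight_le (R : realType) (m : nat) (v : nat -> \bar R)
    (j k : nat) (x y : R) : (1 <= j <= m)%N -> v j = x%:E -> v k = y%:E ->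
  esa_real_weight m v k <= expR (- (y - x)).
Proof.
move=> jm vj vk; rewrite /esa_real_weight vk/= opprB expRD mulrC.
rewrite ler_pM2r ?expR_gt0// -[expR x]invrK -expRN lef_pV2 ?posrE ?expR_gt0//.
  rewrite (bigD1_seq j) ?iota_uniq ?mem_index_iota ?ltnS//= vj/=.
  by rewrite lerDl sumr_ge0// => i _; exact: fine_expeR_ge0.
rewrite (bigD1_seq j) ?iota_uniq ?mem_index_iota ?ltnS//= vj/=.
by rewrite ltr_wpDr ?expR_gt0// sumr_ge0// => i _; exact: fine_expeR_ge0.
Qed.

Lemma esa_mixture_ge0 (R : realType) (dT : nat -> measure_display)
    (Theta : forall k, measurableType (dT k)) (m : nat) (v : nat -> \bar R)
    (Q : forall k, probability (Theta k) R) (A : set {k : nat & Theta k}) :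
  (forall j, (1 <= j <= m)%N -> (0 <= v j)%E) ->
  (0 <= esa_mixture m v Q A)%E.
Proof.
move=> v0; rewrite /esa_mixture big_seq_cond sume_ge0// => k.
rewrite mem_index_iota ltnS andbT => km.
by rewrite esa_weightE// mule_ge0// lee_fin esa_real_weight_ge0.
Qed.

Lemma esa_mixture_le1 (R : realType) (dT : nat -> measure_display)
    (Theta : forall k, measurableType (dT k)) (m : nat) (v : nat -> \bar R)
    (Q : forall k, probability (Theta k) R) (A : set {k : nat & Theta k}) :
  (forall j, (1 <= j <= m)%N -> (0 <= v j)%E) ->
  (forall k, (1 <= k <= m)%N ->
     measurable (existT (fun j => Theta j : Type) k @^-1` A)) ->
  (esa_mixture m v Q A <= 1)%E.
Proof.
move=> v0 mA.
apply: (@le_trans _ _ (\sum_(1 <= k < m.+1) (esa_real_weight m v k)%:E)%E).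
  rewrite /esa_mixture big_seq_cond [leRHS]big_seq_cond lee_sum// => k.
  rewrite mem_index_iota ltnS andbT => km.
  rewrite esa_weightE// -[leRHS]mule1.
  rewrite lee_wpmul2l ?lee_fin ?esa_real_weight_ge0//.
  by rewrite probability_le1//; exact: mA.
by rewrite sumEFin lee_fin sum_esa_real_weight_le1.
Qed.

(* [s] stands for the loss of the true distribution; [mulr_expN_le] absorbs the
   entropy of the weights into the term [2 * ln M + 1]. *)
Lemma esa_mixture_le (R : realType) (dT : nat -> measure_display)
    (Theta : forall k, measurableType (dT k)) (m M ks : nat)
    (v : nat -> \bar R) (Q : forall k, probability (Theta k) R)
    (A : set {k : nat & Theta k}) (a s : R) (D : \bar R) (Y : nat -> \bar R) :
  (m <= M)%N -> (1 <= ks <= m)%N ->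
  (forall j, (1 <= j <= m)%N -> (0 <= v j)%E) ->
  (0 <= D)%E -> (forall k, (0 <= Y k)%E) ->
  (forall k, (1 <= k <= m)%N ->
     measurable (existT (fun j => Theta j : Type) k @^-1` A)) ->
  (v ks <= s%:E + D)%E ->
  (forall k, (1 <= k <= m)%N ->
     (a%:E * Q k (existT (fun j => Theta j : Type) k @^-1` A) + s%:E
       <= v k + (ln M%:R)%:E + Y k)%E) ->
  (a%:E * esa_mixture m v Q A <=
   D + (2 * ln M%:R + 1)%:E + \sum_(1 <= k < M.+1) Y k)%E.
Proof.
move=> mM ksm v0 D0 Y0 mA vks vk.
have M0 : (0 < M)%N.
  by case/andP: ksm => ks1 ksm; rewrite (leq_trans ks1)// (leq_trans ksm).
have SY0 : (0 <= \sum_(1 <= k < M.+1) Y k)%E by exact: sume_ge0.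
case: D D0 vks => [r| |] D0 vks; [|idtac|by []]; last first.
  by rewrite addye ?leey// -ltNye (lt_le_trans _ SY0)// ltNyr.
have [x vksE] : exists x, v ks = x%:E.
  exists (fine (v ks)); rewrite fineK// ge0_fin_numE ?v0//.
  by rewrite (le_lt_trans vks)// -EFinD ltry.
set b := ln M%:R; have b0 : 0 <= b by rewrite ln_ge0// ler1n.
pose w := esa_real_weight m v.
have w0 k : 0 <= w k by exact: esa_real_weight_ge0.
(* The hypothesis for model [k] is multiplied by [w k]. Then [w k * v k] is traded for
   [w k * (v ks + b) + 1 / M] by the entropy estimate, and [v ks <= s + r] makes [s] cancel. *)
have step k : (1 <= k <= m)%N ->
    (a%:E * (esa_weight m v k *
       Q k (existT (fun j => Theta j : Type) k @^-1` A))
      <= (w k * (r + 2 * b) + M%:R^-1)%:E + Y k)%E.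
  move=> km; rewrite esa_weightE// -/(w k).
  have := vk k km; set p := Q k _.
  have pfin : p \is a fin_num by apply: fin_num_measure; exact: mA.
  have M1 : 0 <= M%:R^-1 :> R by rewrite invr_ge0.
  have R0 : 0 <= w k * (r + 2 * b) + M%:R^-1.
    by rewrite addr_ge0// mulr_ge0// addr_ge0 ?mulr_ge0// -lee_fin.
  rewrite -(fineK pfin) -!EFinM.
  have := Y0 k; case: (Y k) => [y| |]// y0; last first.
    by move=> _; rewrite addey ?leey.
  (* A model with infinite objective has weight 0. *)
  have := v0 k km; case vkE : (v k) => [z| |]// z0; last first.
    move=> _; suff -> : w k = 0.
      by rewrite !mul0r mulr0 add0r -EFinD lee_fin addr_ge0.
    by rewrite /w /esa_real_weight vkE/= mul0r.
  rewrite -!EFinD !lee_fin => H.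
  have Hw := esa_real_weight_le ksm vksE vkE; rewrite -/w in Hw.
  have := mulr_expN_le M0 (w0 k) Hw; rewrite -/b => Hb.
  have wk1 : w k <= 1.
    apply: le_trans (sum_esa_real_weight_le1 m v).
    rewrite (bigD1_seq k) ?iota_uniq ?mem_index_iota ?ltnS//=.
    by rewrite lerDl sumr_ge0.
  move: vks; rewrite vksE -EFinD lee_fin => xs.
  rewrite lee_fin in y0.
  have H1 : w k * (a * fine p + s) <= w k * (z + b + y) by rewrite ler_wpM2l.
  have H2 : w k * x <= w k * (s + r) by rewrite ler_wpM2l.
  have H3 : w k * y <= y by rewrite ler_piMl.
  lra.
rewrite /esa_mixture big_seq_cond ge0_sume_distrr; last first.
  move=> k; rewrite mem_index_iota ltnS andbT => km.
  by rewrite esa_weightE// mule_ge0// lee_fin.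
apply: (@le_trans _ _ (\sum_(1 <= k < m.+1)
    ((w k * (r + 2 * b) + M%:R^-1)%:E + Y k))%E).
  rewrite [leRHS]big_seq_cond lee_sum// => k.
  by rewrite mem_index_iota ltnS andbT => km; exact: step.
rewrite big_split/= leeD//; last first.
  (* The sum is extended to [M] because [m] will be the random stopping index. *)
  rewrite (big_cat_nat _ (n := m.+1) (p := M.+1)) ?ltnS//= leeDl//.
  exact: sume_ge0.
rewrite sumEFin -EFinD lee_fin big_split/= -mulr_suml.
have -> : \sum_(1 <= k < m.+1) M%:R^-1 = m%:R * M%:R^-1 :> R.
  by rewrite sumr_const_nat subSS subn0 mulr_natl.
have H1 : m%:R / M%:R <= 1 :> R by rewrite ler_pdivrMr ?ltr0n// mul1r ler_nat.
have H2 : (\sum_(1 <= k < m.+1) w k) * (r + 2 * b) <= r + 2 * b.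
  rewrite ler_piMl ?sum_esa_real_weight_le1// addr_ge0 ?mulr_ge0//.
lra.
Qed.

(** * Measurability, exponential moments and bounds on the objective *)

(** The expectation may be infinite, so Tonelli's theorem is applied to the positive and negative
    parts separately. *)
Lemma measurable_excess_risk d d' (T : measurableType d) (X : measurableType d')
    (R : realType) (P : probability X R) (ell : probability X R -> X -> R)
    (Pmod : T -> probability X R) :
  measurable_fun setT (ell P) ->
  measurable_fun setT (fun p : T * X => ell (Pmod p.1) p.2) ->
  measurable_fun setT (fun theta => excess_risk P ell (Pmod theta)).
Proof.
move=> mell0 mell.
pose f (p : T * X) := (ell (Pmod p.1) p.2 - ell P p.2)%:E.
have mf : measurable_fun setT f.
  apply/measurable_EFinP/measurable_funB => //.
  exact: measurableT_comp.
have -> : (fun theta => excess_risk P ell (Pmod theta)) =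
    (fun theta => fubini_F P f^\+ theta - fubini_F P f^\- theta)%E.
  apply/funext => theta; rewrite /excess_risk unlock integralE /fubini_F.
  by congr (_ - _)%E; apply: eq_integral => x _; rewrite ?funeposE ?funenegE.
apply: emeasurable_funB.
- by apply: measurable_fun_fubini_tonelli_F => //; exact: measurable_funepos.
- by apply: measurable_fun_fubini_tonelli_F => //; exact: measurable_funeneg.
Qed.

(** The common shape of the integrands whose order of integration is exchanged below. *)
Lemma measurable_fun_pair_sum d d' (T : measurableType d)
    (X : measurableType d') (R : realType) (u : T -> R) (v : X -> R)
    (f : T -> X -> R) (a b : R) :
  measurable_fun setT u -> measurable_fun setT v ->
  measurable_fun setT (fun p : T * X => f p.1 p.2) ->
  measurable_fun setT
    (fun p : T * X => (expR (u p.1 + a * f p.1 p.2 + b * v p.2))%:E).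
Proof.
move=> mu mv mf; apply/measurable_EFinP; apply: measurableT_comp => //.
apply: measurable_funD; first apply: measurable_funD.
- exact: measurableT_comp.
- exact: measurable_funM.
- by apply: measurable_funM => //; exact: measurableT_comp.
Qed.

(** Where [r <= l t] the product is [expR (a * (r - l t)) <= 1]; elsewhere the first factor is 1. *)
Lemma expR_indic_le (R : realType) (T : Type) (l : T -> R) (a r : R) (t : T) :
  0 <= a ->
  expR (a * r * \1_[set t | r <= l t] t) * expR (- (a * l t)) <=
    1 + expR (- (a * l t)).
Proof.
move=> a0; rewrite indicE; have [|] := boolP (t \in _); last first.
  by move=> _; rewrite mulr0 expR0 mul1r lerDr.
rewrite inE/= mulr1 -expRD => rl.
rewrite (@le_trans _ _ 1) ?lerDl ?expR_ge0//.
by rewrite -expR0 ler_expR -mulrBr mulr_ge0_le0// subr_le0.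
Qed.

(** After exchanging the integrals, the first bound of condition (i) leaves [expR (- b)] times the
    prior integral of [1 + expR (- (xi1 * l t))]. With [b = ln M] the bound is [2 / M]. *)
Lemma expected_tilting_le d d' (T : measurableType d) (X : measurableType d')
    (R : realType) (P : probability X R) (Pi : probability T R)
    (loss : T -> X -> R) (loss0 : X -> R) (l : T -> R) (lambda xi1 r b : R) :
  0 <= xi1 ->
  measurable_fun setT (fun p : T * X => loss p.1 p.2) ->
  measurable_fun setT loss0 -> measurable_fun setT l ->
  (forall t, (\int[P]_x (expR (- lambda * (loss t x - loss0 x)))%:E <=
     (expR (- (xi1 * l t)))%:E)%E) ->
  (\int[Pi]_t (expR (- (xi1 * l t)))%:E <= 1)%E ->
  (\int[P]_x \int[Pi]_t (expR ((xi1 * r * \1_[set t | (r <= l t)%R] t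
       + lambda * loss0 x) - (lambda * loss t x + b)))%:E <=
     (2 * expR (- b))%:E)%E.
Proof.
move=> xi10 mloss mloss0 ml lossP PiP.
have ml' : measurable [set t | r <= l t].
  rewrite -[X in measurable X]setTI.
  exact: measurable_fun_le.
pose u t := xi1 * r * \1_[set t | (r <= l t)%R] t - b.
have mu : measurable_fun setT u.
  apply: measurable_funB => //; apply: measurable_funM => //.
have mf := measurable_fun_pair_sum (- lambda) lambda mu mloss0 mloss.
have fE x t : (expR ((xi1 * r * \1_[set t | (r <= l t)%R] t
       + lambda * loss0 x) - (lambda * loss t x + b)))%:E =
    (expR (u t + - lambda * loss t x + lambda * loss0 x))%:E.
  congr (expR _)%:E; rewrite /u; lra.
under eq_integral => x _ do under eq_integral => t _ do rewrite fE.
rewrite -(fubini_tonelli (m1 := Pi) (m2 := P) _ mf); last first.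
  by move=> p; rewrite lee_fin expR_ge0.
have mlossS t : measurable_fun setT (loss t).
  exact: (measurableT_comp mloss (pair1_measurable t)).
have mexpl : measurable_fun setT (fun t => (expR (- (xi1 * l t)))%:E).
  apply/measurable_EFinP; apply: measurableT_comp => //.
  by apply: measurableT_comp => //; exact: measurable_funM.
apply: (@le_trans _ _ (\int[Pi]_t
    ((expR (- b))%:E * (1 + (expR (- (xi1 * l t)))%:E)))%E).
  apply: ge0_le_integral => //=.
  - by move=> t _; apply: integral_ge0 => x _; rewrite lee_fin expR_ge0.
  - apply: (measurable_fun_fubini_tonelli_F _ mf) => p.
    by rewrite lee_fin expR_ge0.
  - by apply: emeasurable_funM => //; exact: emeasurable_funD.
  move=> t _.
  have -> : (\int[P]_x (expR (u t + - lambda * loss t x + lambda * loss0 x))%:E =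
      (expR (u t))%:E *
      \int[P]_x (expR (- lambda * (loss t x - loss0 x)))%:E)%E.
    rewrite -ge0_integralZl//=.
    - apply: eq_integral => x _; rewrite -EFinM -expRD; congr (expR _)%:E; lra.
    - apply/measurable_EFinP; apply: measurableT_comp => //.
      by apply: measurable_funM => //; exact: measurable_funB.
  apply: (@le_trans _ _ ((expR (u t))%:E * (expR (- (xi1 * l t)))%:E)%E).
    by rewrite lee_wpmul2l// lee_fin expR_ge0.
  rewrite -EFinD -!EFinM lee_fin /u [_ - b]addrC expRD -[leLHS]mulrA.
  rewrite ler_wpM2l ?expR_ge0//.
  exact: expR_indic_le.
rewrite ge0_integralZl//=; last 2 first.
- exact: emeasurable_funD.
- by move=> t _; rewrite adde_ge0// lee_fin expR_ge0.
rewrite ge0_integralD//=.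
rewrite integral_cst_probability mulrC EFinM lee_wpmul2l ?lee_fin ?expR_ge0//.
by rewrite -[2%:R]/(1 + 1)%R EFinD leeD2l.
Qed.

(** From [y <= expR y] at [y = lambda * xi2 * (loss t - loss0) - c], divided by [xi2]: the loss gap
    is controlled by its exponential moment. The shift by [c] normalises that moment. *)
Lemma vb_objective_le d (T : measurableType d) (R : realType)
    (Pi Q : probability T R) (loss : T -> R) (loss0 lambda xi2 c : R) :
  0 < lambda -> 0 < xi2 -> 0 <= c -> 0 <= loss0 ->
  measurable_fun setT loss -> (forall t, 0 <= loss t) ->
  (KL Q Pi <= c%:E)%E ->
  (vb_objective lambda loss Pi Q <= (lambda * loss0)%:E + ((c / xi2 + c)%:E +
     xi2^-1%:E *
       \int[Q]_t (expR (lambda * xi2 * (loss t - loss0) - c))%:E))%E.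
Proof.
move=> lambda0 xi20 c0 loss00 mloss loss_ge0 KLc.
have mexp : measurable_fun setT
    (fun t => (expR (lambda * xi2 * (loss t - loss0) - c))%:E).
  apply/measurable_EFinP; apply: measurableT_comp => //.
  apply: measurable_funB => //; apply: measurable_funM => //.
  exact: measurable_funB.
have mloss' : measurable_fun setT (EFin \o loss) by exact/measurable_EFinP.
have e0 t : (0 <= (expR (lambda * xi2 * (loss t - loss0) - c))%:E)%E.
  by rewrite lee_fin expR_ge0.
have k0 : (0 <= (lambda * loss0 + c / xi2)%:E)%E.
  by rewrite lee_fin addr_ge0// ?divr_ge0 ?mulr_ge0// ltW.
set W := (_ * \int[Q]_t _)%E.
have -> : ((lambda * loss0)%:E + ((c / xi2 + c)%:E + W) =
    ((lambda * loss0 + c / xi2)%:E + W) + c%:E)%E.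
  by rewrite !EFinD -!addeA [(c%:E + _)%E]addeC.
rewrite /vb_objective leeD// /W.
rewrite -ge0_integralZl//=; [|by move=> t _; rewrite lee_fin|
  by rewrite lee_fin ltW].
rewrite -ge0_integralZl//=; last by rewrite lee_fin invr_ge0 ltW.
rewrite -[X in (X + _)%E](integral_cst_probability Q).
rewrite -ge0_integralD//=; last first.
- by apply: emeasurable_funM.
- by move=> t _; rewrite mule_ge0// lee_fin invr_ge0 ltW.
apply: ge0_le_integral => //=.
- by move=> t _; rewrite mule_ge0// lee_fin// ltW.
- exact: emeasurable_funM.
- by apply: emeasurable_funD => //; exact: emeasurable_funM.
move=> t _; rewrite -!EFinM -EFinD lee_fin.
have := expR_ge1Dx (lambda * xi2 * (loss t - loss0) - c).
set e := expR _ => he.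
have H1 : xi2 * (c / xi2) = c by rewrite mulrC divfK// gt_eqF.
have H2 : xi2 * (xi2^-1 * e) = e by rewrite mulVKf// gt_eqF.
rewrite -(ler_pM2l xi20); lra.
Qed.

(** After exchanging the integrals, the second bound of condition (i) gives [expR (xi3 * l t)], and
    the [expR c] from condition (ii) cancels the shift. *)
Lemma expected_exp_le d d' (T : measurableType d) (X : measurableType d')
    (R : realType) (P : probability X R) (Q : probability T R)
    (loss : T -> X -> R) (loss0 : X -> R) (l : T -> R) (a xi3 c : R) :
  measurable_fun setT (fun p : T * X => loss p.1 p.2) ->
  measurable_fun setT loss0 -> measurable_fun setT l ->
  (forall t, (\int[P]_x (expR (a * (loss t x - loss0 x)))%:E <=
     (expR (xi3 * l t))%:E)%E) ->
  (\int[Q]_t (expR (xi3 * l t))%:E <= (expR c)%:E)%E ->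
  (\int[P]_x \int[Q]_t (expR (a * (loss t x - loss0 x) - c))%:E <= 1)%E.
Proof.
move=> mloss mloss0 ml lossP QP.
have mf := measurable_fun_pair_sum a (- a) (@measurable_cst _ _ T R setT (- c))
  mloss0 mloss.
have fE x t : (expR (a * (loss t x - loss0 x) - c))%:E =
    (expR (- c + a * loss t x + - a * loss0 x))%:E.
  congr (expR _)%:E; lra.
under eq_integral => x _ do under eq_integral => t _ do rewrite fE.
rewrite -(fubini_tonelli (m1 := Q) (m2 := P) _ mf); last first.
  by move=> p; rewrite lee_fin expR_ge0.
have mlossS t : measurable_fun setT (loss t).
  exact: (measurableT_comp mloss (pair1_measurable t)).
have mexpl : measurable_fun setT (fun t => (expR (xi3 * l t))%:E).
  apply/measurable_EFinP; apply: measurableT_comp => //.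
  exact: measurable_funM.
apply: (@le_trans _ _ (\int[Q]_t
    ((expR (- c))%:E * (expR (xi3 * l t))%:E))%E).
  apply: ge0_le_integral => //=.
  - by move=> t _; apply: integral_ge0 => x _; rewrite lee_fin expR_ge0.
  - apply: (measurable_fun_fubini_tonelli_F _ mf) => p.
    by rewrite lee_fin expR_ge0.
  - exact: emeasurable_funM.
  move=> t _.
  have -> : (\int[P]_x (expR (- c + a * loss t x + - a * loss0 x))%:E =
      (expR (- c))%:E *
      \int[P]_x (expR (a * (loss t x - loss0 x)))%:E)%E.
    rewrite -ge0_integralZl//=.
    - apply: eq_integral => x _; rewrite -EFinM -expRD; congr (expR _)%:E; lra.
    - apply/measurable_EFinP; apply: measurableT_comp => //.
      by apply: measurable_funM => //; exact: measurable_funB.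
  by rewrite lee_wpmul2l// lee_fin expR_ge0.
rewrite ge0_integralZl//=.
have e1 : ((expR (- c))%:E * (expR c)%:E = 1)%E.
  by rewrite -EFinM -expRD addNr expR0.
by rewrite -[leRHS]e1 lee_wpmul2l// lee_fin expR_ge0.
Qed.

Lemma vb_objective_ge0 d (T : measurableType d) (R : realType) (lambda : R)
    (loss : T -> R) (Pi Q : probability T R) :
  0 <= lambda -> (forall t, 0 <= loss t) ->
  (0 <= vb_objective lambda loss Pi Q)%E.
Proof.
move=> lambda0 loss0; rewrite adde_ge0 ?KL_ge0// mule_ge0//.
by apply: integral_ge0 => t _; rewrite lee_fin.
Qed.

(** [KL_variational_ge] with [phi = a * \1_B + s] and [psi = lambda * loss + b]; keeping [s] and [b]
    on opposite sides makes both test functions nonnegative. *)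
Lemma vb_objective_tilting_ge d (T : measurableType d) (R : realType)
    (lambda : R) (loss : T -> R) (Pi Q : probability T R) (B : set T)
    (a s b : R) :
  0 <= lambda -> 0 <= a -> 0 <= s -> 0 <= b -> measurable B ->
  measurable_fun setT loss -> (forall t, 0 <= loss t) ->
  (a%:E * Q B + s%:E <= vb_objective lambda loss Pi Q + b%:E +
     \int[Pi]_t (expR ((a * \1_B t + s) - (lambda * loss t + b)))%:E)%E.
Proof.
move=> lambda0 a0 s0 b0 mB mloss loss0.
have mphi : measurable_fun setT (fun t => a * \1_B t + s : R).
  by apply: measurable_funD => //; exact: measurable_funM.
have mpsi : measurable_fun setT (fun t => lambda * loss t + b : R).
  by apply: measurable_funD => //; exact: measurable_funM.
have phi0 t : 0 <= a * \1_B t + s by rewrite addr_ge0// mulr_ge0.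
have psi0 t : 0 <= lambda * loss t + b by rewrite addr_ge0// mulr_ge0.
have := KL_variational_ge Pi Q mphi mpsi phi0 psi0.
have mloss' : measurable_fun setT (EFin \o loss) by exact/measurable_EFinP.
have -> : (\int[Q]_t (lambda * loss t + b)%:E =
    lambda%:E * \int[Q]_t (loss t)%:E + b%:E)%E.
  under eq_integral => t _ do rewrite EFinD EFinM.
  rewrite ge0_integralD//=.
  - rewrite ge0_integralZl//= ?integral_cst_probability//.
    by move=> t _; rewrite lee_fin.
  - by move=> t _; rewrite mule_ge0// lee_fin.
  - exact: emeasurable_funM.
have -> : (\int[Q]_t (a * \1_B t + s)%:E = a%:E * Q B + s%:E)%E.
  have mi : measurable_fun setT (fun t => (\1_B t)%:E : \bar R).
    by apply/measurable_EFinP; exact: measurable_indic.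
  under eq_integral => t _ do rewrite EFinD EFinM.
  rewrite ge0_integralD//=.
  - rewrite ge0_integralZl//= ?integral_cst_probability//.
    by rewrite integral_indic// setIT.
  - by move=> t _; rewrite mule_ge0// lee_fin indicE ler0n.
  - exact: emeasurable_funM.
rewrite /vb_objective => H; apply: le_trans (le_trans H _).
  by rewrite leeDl.
by rewrite leeD2r// addeAC.
Qed.

(** * The bound in expectation *)

(** For [m <= M] the event says that the stopping rule fails at every [k < m], a finite intersection
    of events comparing consecutive objectives. *)
Lemma measurable_le_stopping_index d (X : measurableType d) (R : realType)
    (M m : nat) (v : X -> nat -> \bar R) :
  (forall k, (1 <= k <= M)%N -> measurable_fun setT (v ^~ k)) ->
  measurable [set x | (m <= stopping_index M (v x))%N].
Proof.
move=> mv.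
have -> : [set x | (m <= stopping_index M (v x))%N] =
    if (m <= M)%N then
      \big[setI/setT]_(k <- index_iota 2 M.+1)
         [set x | (v x k.-1 < v x k)%E ==> (m <= k)%N]
    else set0.
  apply/funext => x; apply/propext; rewrite /= leq_bigminn.
  case: ifP => mM //=; rewrite -bigcap_seq; split.
    by move=> /allP xm k /=; exact: xm.
  by move=> xm; apply/allP => k; exact: xm.
case: ifP => // _; rewrite big_seq_cond; apply: bigsetI_measurable => k.
rewrite mem_index_iota ltnS andbT => /andP[k2 kM].
case: (m <= k)%N.
  rewrite (_ : [set _ | _] = setT)//; apply/funext => x; apply/propext.
  by rewrite /= implybT.
rewrite (_ : [set _ | _] = [set x | (v x k <= v x k.-1)%E]).
  rewrite -[X in measurable X]setTI; apply: measurable_lee => //.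
    by apply: mv; rewrite (ltnW k2).
  apply: mv; rewrite (leq_trans (leq_pred _) kM) andbT.
  by case: k k2 {kM}.
by apply/funext => x; apply/propext; rewrite /= implybF leNgt.
Qed.

(** On the event that the stopping index reaches [m], model [ks] is among those aggregated and
    [esa_mixture_le] applies; off this event the mass is at most 1. *)
Lemma expected_esa_mixture_le d (X : measurableType d) (R : realType)
    (P : probability X R) (M : nat) (dT : nat -> measure_display)
    (Theta : forall k, measurableType (dT k))
    (loss : forall k, Theta k -> X -> R) (loss0 : X -> R)
    (l : forall k, Theta k -> R)
    (Pi : forall k, probability (Theta k) R)
    (F : forall k, set (probability (Theta k) R))
    (Qhat : forall k, X -> probability (Theta k) R)
    (A : set {k : nat & Theta k}) (m ks : nat) (Qs : probability (Theta ks) R)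
    (lambda xi1 xi2 xi3 c r : R)
    (v := fun x k => mVFE lambda (fun t => loss k t x) (Pi k) (F k)) :
  0 < lambda -> 0 < xi1 -> 0 < xi2 -> 0 <= c -> 0 < r ->
  (1 <= ks <= m)%N -> (m <= M)%N ->
  (forall k t x, 0 <= loss k t x) -> (forall x, 0 <= loss0 x) ->
  measurable_fun setT loss0 ->
  (forall k, (1 <= k <= M)%N ->
     measurable_fun setT (fun p : Theta k * X => loss k p.1 p.2)) ->
  (forall k, (1 <= k <= M)%N -> measurable_fun setT (l k)) ->
  (forall k, (1 <= k <= M)%N -> measurable_fun setT (v ^~ k)) ->
  (forall k, (1 <= k <= M)%N -> forall x,
     is_minimizer (vb_objective lambda (fun t => loss k t x) (Pi k))
       (F k) (Qhat k x)) ->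
  (forall k, (1 <= k <= M)%N -> forall t,
     (\int[P]_x (expR (- lambda * (loss k t x - loss0 x)))%:E <=
        (expR (- (xi1 * l k t)))%:E)%E) ->
  (forall k, (1 <= k <= M)%N ->
     (\int[Pi k]_t (expR (- (xi1 * l k t)))%:E <= 1)%E) ->
  F ks Qs -> (KL Qs (Pi ks) <= c%:E)%E ->
  (forall t, (\int[P]_x (expR (lambda * xi2 * (loss ks t x - loss0 x)))%:E <=
     (expR (xi3 * l ks t))%:E)%E) ->
  (\int[Qs]_t (expR (xi3 * l ks t))%:E <= (expR c)%:E)%E ->
  (forall k, (1 <= k <= M)%N ->
     existT (fun j => Theta j : Type) k @^-1` A = [set t | r <= l k t]) ->
  (\int[P]_x esa_mixture (stopping_index M (v x)) (v x) (fun k => Qhat k x) A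
    <= 1 - P [set x | (m <= stopping_index M (v x))%N] +
       (((c + 1) / xi2 + c + 2 * ln M%:R + 3) / (xi1 * r))%:E)%E.
Proof.
move=> lambda0 xi10 xi20 c0 r0 ksm mM loss_ge0 loss0_ge0 mloss0 mloss ml mv.
move=> Qhat_min lossP PiP FQs KLQs lossQ QsP AE.
have M0 : (0 < M)%N.
  by case/andP: ksm => k1 km; rewrite (leq_trans k1)// (leq_trans km).
have ksM : (1 <= ks <= M)%N by case/andP: ksm => -> /leq_trans->.
have b0 : 0 <= ln M%:R :> R by rewrite ln_ge0// ler1n.
set a := xi1 * r; have a0 : 0 < a by rewrite mulr_gt0.
set G := [set x | _].
have mG : measurable G by exact: measurable_le_stopping_index.
have v0 x k : (1 <= k <= M)%N -> (0 <= v x k)%E.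
  move=> kM; apply: le_ereal_inf_tmp => _ [Q _ <-].
  by rewrite vb_objective_ge0// ltW.
have mA k : (1 <= k <= M)%N ->
    measurable (existT (fun j => Theta j : Type) k @^-1` A).
  move=> kM; rewrite AE// -[X in measurable X]setTI.
  by apply: measurable_fun_le => //; exact: ml.
have mlossX k x : (1 <= k <= M)%N -> measurable_fun setT (fun t => loss k t x).
  by move=> kM; exact: (measurableT_comp (mloss k kM) (pair2_measurable x)).
(* The remainder of the tilting bound, set to 0 outside [[M]], where the hypotheses on the models
   say nothing. *)
pose Y k x : \bar R := if (1 <= k <= M)%N then
  (\int[Pi k]_t (expR ((a * \1_[set t | (r <= l k t)%R] t + lambda * loss0 x) -
    (lambda * loss k t x + ln M%:R)))%:E)%E else 0%E.
have Y0 k x : (0 <= Y k x)%E.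
  rewrite /Y; case: ifP => // _; apply: integral_ge0 => t _.
  by rewrite lee_fin expR_ge0.
have mY k : measurable_fun setT (Y k).
  have [kM|/negPf kM] := boolP (1 <= k <= M)%N; last first.
    by rewrite (_ : Y k = cst 0%E)//; apply/funext => x; rewrite /Y kM.
  have mu : measurable_fun setT
      (fun t => a * \1_[set t | r <= l k t] t - ln M%:R).
    apply: measurable_funB => //; apply: measurable_funM => //.
    by apply: measurable_indic; rewrite -AE//; exact: mA.
  have mf := measurable_fun_pair_sum (- lambda) lambda mu mloss0 (mloss k kM).
  rewrite (_ : Y k = fubini_G (Pi k) (fun p : Theta k * X =>
      (expR (a * \1_[set t | r <= l k t] p.1 - ln M%:R +
        - lambda * loss k p.1 p.2 + lambda * loss0 p.2))%:E)).
    apply: (measurable_fun_fubini_tonelli_G _ mf) => p.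
    by rewrite lee_fin expR_ge0.
  apply/funext => x; rewrite /Y kM; apply: eq_integral => t _ /=.
  congr (expR _)%:E; lra.
have EY k : (\int[P]_x Y k x <= (2 / M%:R)%:E)%E.
  have [kM|/negPf kM] := boolP (1 <= k <= M)%N; last first.
    by under eq_integral do rewrite /Y kM; rewrite integral0 lee_fin divr_ge0.
  under eq_integral do rewrite /Y kM.
  have -> : 2 / M%:R = 2 * expR (- ln M%:R) :> R.
    by rewrite expRN lnK// posrE ltr0n.
  by apply: expected_tilting_le; [exact: ltW|exact: mloss|done|exact: ml|
    exact: lossP|exact: PiP].
pose W x := (\int[Qs]_t
  (expR (lambda * xi2 * (loss ks t x - loss0 x) - c))%:E)%E.
have W0 x : (0 <= W x)%E.
  by apply: integral_ge0 => t _; rewrite lee_fin expR_ge0.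
have mW : measurable_fun setT W.
  have mf := measurable_fun_pair_sum (lambda * xi2) (- (lambda * xi2))
    (@measurable_cst _ _ (Theta ks) R setT (- c)) mloss0 (mloss ks ksM).
  rewrite (_ : W = fubini_G Qs (fun p : Theta ks * X =>
      (expR (- c + lambda * xi2 * loss ks p.1 p.2 +
         - (lambda * xi2) * loss0 p.2))%:E)).
    apply: (measurable_fun_fubini_tonelli_G _ mf) => p.
    by rewrite lee_fin expR_ge0.
  apply/funext => x; apply: eq_integral => t _ /=.
  congr (expR _)%:E; lra.
have EW : (\int[P]_x W x <= 1)%E.
  by apply: (expected_exp_le (mloss ks ksM) mloss0 (ml ks ksM) lossQ QsP).
pose D x := ((c / xi2 + c)%:E + xi2^-1%:E * W x)%E.
have k0 : 0 <= c / xi2 + c by rewrite addr_ge0// divr_ge0// ltW.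
have D0 x : (0 <= D x)%E.
  by rewrite adde_ge0 ?lee_fin// mule_ge0// lee_fin invr_ge0 ltW.
have mD : measurable_fun setT D.
  by apply: emeasurable_funD => //; exact: emeasurable_funM.
pose U x := (D x + (2 * ln M%:R + 1)%:E + \sum_(1 <= k < M.+1) Y k x)%E.
have mU : measurable_fun setT U.
  apply: emeasurable_funD; last exact: emeasurable_sum.
  exact: emeasurable_funD.
have U0 x : (0 <= U x)%E.
  rewrite adde_ge0 ?sume_ge0// adde_ge0// lee_fin.
  by rewrite addr_ge0// mulr_ge0.
have mhat x : (1 <= stopping_index M (v x) <= M)%N.
  exact: stopping_index_bounds.
have mhatW x k : (1 <= k <= stopping_index M (v x))%N -> (1 <= k <= M)%N.
  by case/andP => -> /leq_trans; apply; case/andP: (mhat x).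
have QU x : G x -> (a%:E * esa_mixture (stopping_index M (v x)) (v x)
    (fun k => Qhat k x) A <= U x)%E.
  move=> Gx.
  apply: (@esa_mixture_le _ _ _ _ _ ks _ _ _ _ (lambda * loss0 x)) => //.
  - by case/andP: (mhat x).
  - by case/andP: ksm => -> /leq_trans->.
  - by move=> j /mhatW/v0.
  - by move=> k /mhatW/mA.
  - apply: (@le_trans _ _
      (vb_objective lambda (fun t => loss ks t x) (Pi ks) Qs)).
      by apply: ereal_inf_lbound; exists Qs.
    by apply: vb_objective_le => //; exact: mlossX.
  move=> k /mhatW kM.
  apply: (@le_trans _ _ (vb_objective lambda (fun t => loss k t x) (Pi k)
      (Qhat k x) + (ln M%:R)%:E + Y k x)%E).
    rewrite /Y kM AE//; apply: vb_objective_tilting_ge => //.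
    - exact: ltW.
    - exact: ltW.
    - by rewrite mulr_ge0// ltW.
    - by rewrite -AE//; exact: mA.
    - exact: mlossX.
  rewrite leeD2r// leeD2r//; apply: le_ereal_inf_tmp => _ [Q FQ <-].
  by have [_] := Qhat_min k kM x; exact.
have Qle x : (esa_mixture (stopping_index M (v x)) (v x) (fun k => Qhat k x) A
    <= (\1_(~` G) x)%:E + a^-1%:E * U x)%E.
  have [Gx|nGx] := pselect (G x).
    rewrite indicE memNset ?add0e; last by move=> /(_ Gx).
    rewrite -(@lee_pmul2l _ a%:E) ?lte_fin// muleA -EFinM divff ?gt_eqF// mul1e.
    exact: QU.
  rewrite indicE mem_set//=; apply: (@le_trans _ _ 1%E); last first.
    by rewrite leeDl// mule_ge0// lee_fin invr_ge0 ltW.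
  apply: esa_mixture_le1 => [j /mhatW/v0//|k /mhatW/mA//].
have mGC : measurable (~` G) by exact: measurableC.
apply: (@le_trans _ _ (\int[P]_x ((\1_(~` G) x)%:E + a^-1%:E * U x))%E).
  apply: ge0_le_integral_any => // x.
  by apply: esa_mixture_ge0 => j /mhatW/v0.
have mi : measurable_fun setT (fun x => (\1_(~` G) x)%:E : \bar R).
  by apply/measurable_EFinP; exact: measurable_indic.
rewrite ge0_integralD//; last 2 first.
- by move=> x _; rewrite mule_ge0// lee_fin invr_ge0 ltW.
- exact: emeasurable_funM.
rewrite integral_indic//.
rewrite setIT.
rewrite -(probability_setC P mG) leeD2l//.
rewrite ge0_integralZl//; last by rewrite lee_fin invr_ge0 ltW.
rewrite mulrC EFinM lee_wpmul2l ?lee_fin ?invr_ge0 ?(ltW a0)//.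
have -> : (\int[P]_x U x = \int[P]_x D x + (2 * ln M%:R + 1)%:E +
    \sum_(1 <= k < M.+1) \int[P]_x Y k x)%E.
  rewrite ge0_integralD//; last 4 first.
  - by move=> x _; rewrite adde_ge0// lee_fin addr_ge0// mulr_ge0.
  - exact: emeasurable_funD.
  - by move=> x _; exact: sume_ge0.
  - exact: emeasurable_sum.
  rewrite ge0_integral_sum// ge0_integralD//; last first.
    by move=> x _; rewrite lee_fin addr_ge0// mulr_ge0.
  by rewrite integral_cst_probability.
have -> : (\int[P]_x D x = (c / xi2 + c)%:E + xi2^-1%:E * \int[P]_x W x)%E.
  rewrite ge0_integralD//; last 2 first.
  - by move=> x _; rewrite mule_ge0// lee_fin invr_ge0 ltW.
  - exact: emeasurable_funM.
  by rewrite integral_cst_probability ge0_integralZl// lee_fin invr_ge0 ltW.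
(* The final 3 is the 1 from the entropy of the weights plus [M] remainders of [2 / M]. *)
apply: (@le_trans _ _ (((c / xi2 + c)%:E + xi2^-1%:E * 1) +
    (2 * ln M%:R + 1)%:E + \sum_(1 <= k < M.+1) (2 / M%:R)%:E)%E).
  rewrite leeD ?lee_sum// leeD2r// leeD2l// lee_wpmul2l// lee_fin invr_ge0.
  exact: ltW.
rewrite sumEFin mule1 -!EFinD lee_fin sumr_const_nat subSS subn0.
have -> : 2 / M%:R *+ M = 2 :> R.
  by rewrite -[_ *+ M]mulr_natr divfK// pnatr_eq0 gtn_eqF.
lra.
Qed.

(** * Finiteness of the excess risk and the bound for one sample size *)

Lemma integral_expR_gt0 d (T : measurableType d) (R : realType)
    (P : probability T R) (f : T -> R) :
  measurable_fun setT f -> (0 < \int[P]_x (expR (f x))%:E)%E.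
Proof.
move=> mf; have mexp : measurable_fun setT (fun x => (expR (f x))%:E).
  by apply/measurable_EFinP; exact: measurableT_comp.
have int_ge0 : (0 <= \int[P]_x (expR (f x))%:E)%E.
  by apply: integral_ge0 => x _; rewrite lee_fin expR_ge0.
rewrite lt_neqAle int_ge0 andbT; apply/eqP => /esym int0.
have : (\int[P]_x `|(expR (f x))%:E| = 0)%E.
  rewrite -int0; apply: eq_integral => x _.
  by rewrite gee0_abs// lee_fin expR_ge0.
move/(ae_eq_integral_abs P measurableT mexp) => [N [mN N0 subN]].
have NT : N = setT.
  apply/seteqP; split => // x _; apply: subN => /= /(_ I) [] /eqP.
  by rewrite gt_eqF// expR_gt0.
have := probability_setT P; rewrite -NT N0 => /eqP.
by rewrite eqe eq_sym oner_eq0.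
Qed.

(** At [x = +oo] the first bound, and at [x = -oo] the second, would make the expectation of a
    positive function at most 0. *)
Lemma excess_risk_fin_num d (X : measurableType d) (R : realType)
    (P : probability X R) (f g : X -> R) (a b : R) (x : \bar R) :
  0 < a -> 0 < b -> measurable_fun setT f -> measurable_fun setT g ->
  ('E_P[fun x => expR (f x)] <= expeR (- (a%:E * x)))%E ->
  ('E_P[fun x => expR (g x)] <= expeR (b%:E * x))%E ->
  x \is a fin_num.
Proof.
move=> a0 b0 mf mg; rewrite unlock.
have := integral_expR_gt0 P mf; have := integral_expR_gt0 P mg.
case: x => [//| |] g0 f0.
  by rewrite gt0_muley ?lte_fin// => /(lt_le_trans f0); rewrite /= ltxx.
move=> _; rewrite gt0_muleNy ?lte_fin// => /(lt_le_trans g0).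
by rewrite /= ltxx.
Qed.

(** The strict bound on [eta] is what [eta -> 0] provides for large [n]; it yields [1 <= Estar], so
    that additive constants are absorbed by [Estar]. *)
Lemma expected_esa_excess_risk_le d (X : measurableType d) (R : realType)
    (Pstar : probability X R) (ell : probability X R -> X -> R)
    (M : nat) (dT : nat -> measure_display)
    (Theta : forall k, measurableType (dT k))
    (Pmod : forall k, Theta k -> probability X R)
    (lambda : R) (Pi : forall k, probability (Theta k) R)
    (F : forall k, set (probability (Theta k) R))
    (Qhat : forall k, X -> probability (Theta k) R)
    (xi1 xi2 xi3 xi4 tau C2 A : R)
    (L := fun k theta => excess_risk Pstar ell (Pmod k theta))
    (vfe := fun x k =>
       mVFE lambda (fun theta => ell (Pmod k theta) x) (Pi k) (F k))
    (E := fun k => model_excess_risk xi1 (L k) (Pi k))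
    (kd := near_optimal_index M E tau)
    (Estar := min_upto M kd.+1 E)
    (eta := (((kd)%:R)%:E * expeR (- (C2%:E * E kd)))%E) :
  (forall P x, 0 <= ell P x) -> measurable_fun setT (ell Pstar) ->
  (0 < M)%N ->
  (forall k, (1 <= k <= M)%N ->
     measurable_fun setT (fun p : Theta k * X => ell (Pmod k p.1) p.2)) ->
  0 < lambda ->
  (forall k, (1 <= k <= M)%N -> forall x,
     is_minimizer
       (vb_objective lambda (fun theta => ell (Pmod k theta) x) (Pi k))
       (F k) (Qhat k x)) ->
  (forall k, (1 <= k <= M)%N -> measurable_fun setT (vfe ^~ k)) ->
  0 < xi1 -> 0 < xi2 -> 0 < xi3 -> 0 < xi4 -> 0 < tau -> 0 < C2 -> 0 < A ->
  (forall k, (1 <= k <= M)%N -> forall theta : Theta k,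
     ('E_Pstar[fun x => expR
          (- lambda * (ell (Pmod k theta) x - ell Pstar x))]
        <= expeR (- (xi1%:E * L k theta)))%E /\
     ('E_Pstar[fun x => expR
          (lambda * xi2 * (ell (Pmod k theta) x - ell Pstar x))]
        <= expeR (xi3%:E * L k theta))%E) ->
  (forall k, (1 <= k <= M)%N ->
     exists2 Q : probability (Theta k) R, F k Q &
       (lne (\int[Q]_theta expeR (xi3%:E * L k theta)) <= xi4%:E * E k)%E /\
       (KL Q (Pi k) <= xi4%:E * E k)%E) ->
  (1 - eta <=
     Pstar [set x | (minn kd.+1 M <= stopping_index M (vfe x))%N])%E ->
  (eta < (expR (- (C2 * (1 + tau))))%:E)%E ->
  (\int[Pstar]_x esa_mixture (stopping_index M (vfe x)) (vfe x)
     (fun k => Qhat k x)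
     [set theta : {k : nat & Theta k} |
       A%:E * (Estar + (ln M%:R)%:E) <= L (projT1 theta) (projT2 theta)]
   <= eta + (((xi4 + 1) / xi2 + xi4 + 5) / xi1 * A^-1)%:E)%E.
Proof.
move=> ell0 mell0 M0 mell lambda0 Qmin mvfe xi10 xi20 xi30 xi40 tau0 C20 A0.
move=> condi condii stop eta_lt.
have kdM : (1 <= kd <= M)%N by exact: near_optimal_index_bounds.
have b0 : 0 <= ln M%:R :> R by rewrite ln_ge0// ler1n.
have mellX k theta : (1 <= k <= M)%N ->
    measurable_fun setT (ell (Pmod k theta)).
  by move=> kM; exact: (measurableT_comp (mell k kM) (pair1_measurable theta)).
have Lfin k theta : (1 <= k <= M)%N -> L k theta \is a fin_num.
  move=> kM; have [H1 H2] := condi k kM theta.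
  apply: (excess_risk_fin_num xi10 xi30 _ _ H1 H2).
    by apply: measurable_funM => //; apply: measurable_funB => //; exact: mellX.
  by apply: measurable_funM => //; apply: measurable_funB => //; exact: mellX.
pose l k theta := fine (L k theta).
have LE k theta : (1 <= k <= M)%N -> L k theta = (l k theta)%:E.
  by move=> kM; rewrite fineK// Lfin.
have E0 k : (1 <= k <= M)%N -> (0 <= E k)%E.
  move=> kM; have [Q _ [_ KLQ]] := condii k kM.
  by rewrite -(@pmule_rge0 _ xi4%:E) ?lte_fin// (le_trans (KL_ge0 _ _) KLQ).
have eta0 : (0 <= eta)%E by rewrite mule_ge0 ?expeR_ge0// lee_fin.
have eta_fin : eta \is a fin_num.
  by rewrite ge0_fin_numE// (lt_trans eta_lt)// ltry.
(* As [kd >= 1], the exponential in [eta] is itself at most [eta]. *)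
have Ekd : ((1 + tau)%:E <= E kd)%E.
  rewrite ltW// -(@lte_pmul2l _ C2%:E) ?lte_fin// -EFinM -lteN2 -lte_expeR.
  rewrite (le_lt_trans _ eta_lt)// lee_pemull ?expeR_ge0// lee_fin ler1n.
  by case/andP: kdM.
have Estar1 : (1%:E <= Estar)%E.
  by apply: min_upto_near_optimal_ge => //; rewrite mulr1.
have C0 : 0 <= ((xi4 + 1) / xi2 + xi4 + 5) / xi1.
  rewrite divr_ge0 ?(ltW xi10)// !addr_ge0 ?(ltW xi40)//.
  by rewrite divr_ge0 ?(ltW xi20)// addr_ge0// ltW.
have mhat x : (1 <= stopping_index M (vfe x) <= M)%N.
  exact: stopping_index_bounds.
set B := [set theta | _].
(* With an infinite threshold the set is empty on each model, as the excess risks are finite. *)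
have [Ey|Efin] := eqVneq Estar +oo%E.
  rewrite (eq_integral (cst 0%E)) ?integral0.
    by rewrite adde_ge0// lee_fin mulr_ge0// invr_ge0 ltW.
  move=> x _; rewrite /esa_mixture big_seq_cond big1// => k.
  rewrite mem_index_iota ltnS andbT => /andP[k1 km].
  have kM : (1 <= k <= M)%N.
    by rewrite k1 (leq_trans km)//; case/andP: (mhat x).
  rewrite (_ : _ @^-1` B = set0) ?measure0 ?mule0//.
  apply/seteqP; split => // theta.
  by rewrite /B /= Ey addye// gt0_muley ?lte_fin// LE.
have [ks [ksM kskd EsE]] : exists k,
    [/\ (1 <= k <= M)%N, (k <= kd.+1)%N & Estar = E k].
  by have [Ey|//] := min_upto_eq M kd.+1 E; rewrite /Estar Ey eqxx in Efin.
have [e EsR] : exists e, E ks = e%:E.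
  by exists (fine (E ks)); rewrite fineK// ge0_fin_numE ?E0// -EsE ltey.
have e1 : 1 <= e by rewrite -lee_fin -EsR -EsE.
have e0 : 0 <= e by rewrite (le_trans _ e1).
pose c := xi4 * e; pose r := A * (e + ln M%:R).
have c0 : 0 <= c by rewrite mulr_ge0// ltW.
have eb0 : 0 < e + ln M%:R by rewrite ltr_wpDr// (lt_le_trans _ e1).
have r0 : 0 < r by rewrite mulr_gt0.
have [Qs FQs [lneQ KLQ]] := condii ks ksM.
have HB k : (1 <= k <= M)%N ->
    existT (fun j => Theta j : Type) k @^-1` B = [set t | r <= l k t].
  move=> kM; apply/funext => t; apply/propext; rewrite /B /=.
  by rewrite EsE EsR -EFinD -EFinM LE// lee_fin.
have := @expected_esa_mixture_le _ X R Pstar M dT Theta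
  (fun k theta => ell (Pmod k theta)) (ell Pstar) l Pi F Qhat B (minn kd.+1 M)
  ks Qs lambda xi1 xi2 xi3 c r lambda0 xi10 xi20 c0 r0.
have ml k : (1 <= k <= M)%N -> measurable_fun setT (l k).
  move=> kM; apply: measurableT_comp => //.
  by apply: measurable_excess_risk => //; exact: mell.
have H1 k : (1 <= k <= M)%N -> forall t,
    (\int[Pstar]_x (expR (- lambda * (ell (Pmod k t) x - ell Pstar x)))%:E <=
        (expR (- (xi1 * l k t)))%:E)%E.
  by move=> kM t; have [] := condi k kM t; rewrite unlock LE.
(* This is [0 <= E k] read through the logarithm. *)
have H2 k : (1 <= k <= M)%N ->
    (\int[Pi k]_t (expR (- (xi1 * l k t)))%:E <= 1)%E.
  move=> kM; have := E0 k kM; rewrite /E /model_excess_risk leeNr oppe0 lne_le0.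
  by under eq_integral do rewrite LE//.
have H3 t : (\int[Pstar]_x (expR (lambda * xi2 *
    (ell (Pmod ks t) x - ell Pstar x)))%:E <= (expR (xi3 * l ks t))%:E)%E.
  by have [] := condi ks ksM t; rewrite unlock LE.
have H4 : (\int[Qs]_t (expR (xi3 * l ks t))%:E <= (expR c)%:E)%E.
  move: lneQ; under eq_integral do rewrite LE//.
  rewrite EsR -EFinM -/c -lee_expeR lneK// in_itv/= leey andbT.
  by apply: integral_ge0 => t _; rewrite lee_fin expR_ge0.
rewrite EsR -EFinM -/c in KLQ.
move=> /(_ _ (geq_minr _ _) (fun k t x => ell0 _ _) (ell0 _) mell0 mell ml mvfe
  Qmin H1 H2 FQs KLQ H3 H4 HB).
rewrite leq_min kskd => H; apply: (le_trans (H _)).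
  by move: ksM => /andP[-> ->].
apply: leeD.
  rewrite leeBlDr -?leeBlDl//; apply: fin_num_measure.
  exact: measurable_le_stopping_index.
rewrite lee_fin /r ler_pdivrMr ?mulr_gt0//.
have -> : ((xi4 + 1) / xi2 + xi4 + 5) / xi1 / A * (xi1 * (A * (e + ln M%:R))) =
    ((xi4 + 1) / xi2 + xi4 + 5) * (e + ln M%:R).
  by field; rewrite !gt_eqF.
(* Since [e >= 1], each term is at most a constant times [e + ln M]; in particular [2 * ln M + 3] is
   at most 5 times it. *)
have H5 : (c + 1) / xi2 <= (xi4 + 1) / xi2 * (e + ln M%:R).
  rewrite mulrAC ler_pM2r ?invr_gt0// /c.
  have := mulr_ge0 (ltW xi40) b0; lra.
have := mulr_ge0 (ltW xi40) b0; rewrite /c in H5 *; lra.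
Qed.

Theorem theorem3p3 (R : realType)
  (* sample spaces, true distributions, losses *)
  (dX : nat -> measure_display) (X : forall n, measurableType (dX n))
  (Pstar : forall n, probability (X n) R)
  (ell : forall n, probability (X n) R -> X n -> R)
  (ell_ge0 : forall n P x, 0 <= ell n P x)
  (ell_star_meas : forall n, measurable_fun setT (ell n (Pstar n)))
  (* nested models, indexed by k in [M n] *)
  (M : nat -> nat) (M_gt0 : forall n, (0 < M n)%N)
  (dT : nat -> nat -> measure_display)
  (Theta : forall n k, measurableType (dT n k))
  (Pmod : forall n k, Theta n k -> probability (X n) R)
  (nested : forall n k, (1 <= k < M n)%N ->
     exists T : Theta n k -> Theta n k.+1,
       injective T /\ forall theta, Pmod n k theta = Pmod n k.+1 (T theta))
  (ell_meas : forall n k, (1 <= k <= M n)%N ->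
     measurable_fun setT
       (fun p : Theta n k * X n => ell n (Pmod n k p.1) p.2))
  (* variational Bayes *)
  (lambda : R) (lambda_gt0 : 0 < lambda)
  (Pi : forall n k, probability (Theta n k) R)
  (F : forall n k, set (probability (Theta n k) R))
  (Qhat : forall n k, X n -> probability (Theta n k) R)
  (Qhat_min : forall n k, (1 <= k <= M n)%N -> forall x,
     is_minimizer
       (vb_objective lambda (fun theta => ell n (Pmod n k theta) x) (Pi n k))
       (F n k) (Qhat n k x))
  (Qhat_meas : forall n k, (1 <= k <= M n)%N ->
     forall A : set (Theta n k), measurable A ->
     measurable_fun setT (fun x => Qhat n k x A))
  (mvfe_meas : forall n k, (1 <= k <= M n)%N ->
     measurable_fun setT (fun x =>
       mVFE lambda (fun theta => ell n (Pmod n k theta) x) (Pi n k) (F n k)))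
  (xi1 xi2 xi3 xi4 tau C2 : R)
  (xi1_gt0 : 0 < xi1) (xi2_gt0 : 0 < xi2) (xi3_gt0 : 0 < xi3)
  (xi4_gt0 : 0 < xi4) (tau_gt0 : 0 < tau) (C2_gt0 : 0 < C2) :
  let L n k (theta : Theta n k) : \bar R :=
    excess_risk (Pstar n) (ell n) (Pmod n k theta) in
  let vfe n (x : X n) k : \bar R :=
    mVFE lambda (fun theta => ell n (Pmod n k theta) x) (Pi n k) (F n k) in
  let mhat n (x : X n) : nat := stopping_index (M n) (vfe n x) in
  let QESA n (x : X n) : set {k : nat & Theta n k} -> \bar R :=
    esa_mixture (mhat n x) (vfe n x) (fun k => Qhat n k x) in
  let E n k : \bar R := model_excess_risk xi1 (L n k) (Pi n k) in
  let kd n : nat := near_optimal_index (M n) (E n) tau in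
  let Estar n : \bar R := min_upto (M n) (kd n).+1 (E n) in
  let eta n : \bar R :=
    (((kd n)%:R)%:E * expeR (- (C2%:E * E n (kd n))))%E in
  (* condition (i) *)
  (\forall n \near \oo, forall k, (1 <= k <= M n)%N ->
     forall theta : Theta n k,
     ('E_(Pstar n)[fun x => expR
          (- lambda * (ell n (Pmod n k theta) x - ell n (Pstar n) x))]
        <= expeR (- (xi1%:E * L n k theta)))%E /\
     ('E_(Pstar n)[fun x => expR
          (lambda * xi2 * (ell n (Pmod n k theta) x - ell n (Pstar n) x))]
        <= expeR (xi3%:E * L n k theta))%E) ->
  (* condition (ii) *)
  (\forall n \near \oo, forall k, (1 <= k <= M n)%N ->
     exists2 Q : probability (Theta n k) R, F n k Q &
       (lne (\int[Q]_theta expeR (xi3%:E * L n k theta))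
          <= xi4%:E * E n k)%E /\
       (KL Q (Pi n k) <= xi4%:E * E n k)%E) ->
  (* stopping index exceeds the near-optimal index with high probability *)
  (\forall n \near \oo,
     (1 - eta n <=
        Pstar n [set x | (minn (kd n).+1 (M n) <= mhat n x)%N])%E) ->
  eta n @[n --> \oo] --> 0%E ->
  forall A : nat -> R, A n @[n --> \oo] --> +oo ->
  (\int[Pstar n]_x QESA n x
     [set theta : {k : nat & Theta n k} |
       (A n)%:E * (Estar n + (ln (M n)%:R)%:E)
         <= L n (projT1 theta) (projT2 theta)])%E @[n --> \oo] --> 0%E.
Proof.
move=> L vfe mhat QESA E kd Estar eta condi condii stop eta_cvg A A_cvg.
have A_gt0 : \forall n \near \oo, 0 < A n by exact: cvgry_gt.
(* This threshold is the value of [expR (- (C2 * y))] at [y = 1 + tau], the level that [E n (kd n)]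
   has to reach. *)
have eta_lt : \forall n \near \oo,
    (eta n < (expR (- (C2 * (1 + tau))))%:E)%E.
  apply: (eta_cvg (fun x => (x < (expR (- (C2 * (1 + tau))))%:E)%E)).
  by apply: open_ereal_lt'; rewrite lte_fin expR_gt0.
pose C := ((xi4 + 1) / xi2 + xi4 + 5) / xi1.
(* The mass is squeezed between 0 and [eta n + C / A n], where [C] does not depend on [n]. *)
apply: (@squeeze_cvge _ _ _ _ (cst 0%E) _
  (fun n => eta n + (C * (A n)^-1)%:E)%E).
- near=> n; apply/andP; split.
    apply: integral_ge0 => x _; apply: esa_mixture_ge0 => k km.
    have /andP[_ mM] : (1 <= mhat n x <= M n)%N by exact: stopping_index_bounds.
    apply: le_ereal_inf_tmp => _ [Q _ <-].
    by rewrite vb_objective_ge0// ltW.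
  apply: (@expected_esa_excess_risk_le _ _ _ _ _ _ _ _ _ _ _ _ _
    xi1 xi2 xi3 xi4 tau C2 (A n)) => //.
  + exact: ell_meas.
  + exact: Qhat_min.
  + exact: mvfe_meas.
  + by near: n.
  + by near: n.
  + by near: n.
  + by near: n.
  + by near: n.
- exact: cvg_cst.
- rewrite -[0%E]adde0; apply: cvgeD => //.
  apply/cvg_EFin; first by near=> n.
  rewrite -[0](mulr0 C); apply: cvgMl_tmp.
  exact/gtr0_cvgV0.
Unshelve. all: by end_near.
Qed.
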